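(* Let $F:\mathcal{C}\to\mathcal{D}$ be a tensor functor between fusion categories over a field $\Bbbk$ and let $\mathcal{D}'$ be its dominant image. The following assertions are equivalent: (i) $F$ is normal; (ii) for all $X,X'\in\Lambda_{\mathcal{C}}$, the sets $X^F$ and $X'^F$ are either disjoint or equal; (iii) for all $Y,Y'\in\Lambda_{\mathcal{D}'}$, the sets $Y_F$ and $Y'_F$ are either disjoint or equal.
   Context: A fusion category over a field $\Bbbk$ is a $\Bbbk$-linear semisimple rigid monoidal category with finitely many isomorphism classes of simple objects, finite dimensional Hom spaces, such that $\mathrm{End}(S)=\Bbbk$ for every simple object $S$, and whose unit object $\mathbf{1}$ is simple. A fusion subcategory is a full replete monoidal subcategory which is itself a fusion category. $\Lambda_{\mathcal{C}}$ is the set of isomorphism classes of simple objects of $\mathcal{C}$. ''Factor'' means direct summand. An object is trivial if it is isomorphic to $\mathbf{1}^n$ for some $n\in\mathbb{N}$. A tensor functor is a strong monoidal $\Bbbk$-linear functor. The dominant image of $F$ is the fusion subcategory $\mathcal{D}'\subset\mathcal{D}$ generated by the image of $F$. $F$ is normal if for every $X\in\Lambda_{\mathcal{C}}$ such that $F(X)$ contains $\mathbf{1}$ as a factor, $F(X)$ is trivial. For $X\in\Lambda_{\mathcal{C}}$, $X^F=\{Y\in\Lambda_{\mathcal{D}}\mid Y\text{ is a factor of }F(X)\}$; for $Y\in\Lambda_{\mathcal{D}}$, $Y_F=\{X\in\Lambda_{\mathcal{C}}\mid Y\text{ is a factor of }F(X)\}$. *)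

(* Defs.v *)
From mathcomp Require Import all_boot all_order all_algebra.
From mathcomp Require Import boolp classical_sets functions cardinality.

Set Implicit Arguments.
Unset Strict Implicit.
Unset Printing Implicit Defensive.

Import GRing.Theory.
Local Open Scope classical_set_scope.
Local Open Scope ring_scope.

Declare Scope cat_scope.
Delimit Scope cat_scope with cat.
Local Open Scope cat_scope.
Reserved Notation "g \oc f" (at level 45, left associativity).
Reserved Notation "X \ox Y" (at level 40, left associativity).
Reserved Notation "f \om g" (at level 40, left associativity).

(* Finite-dimensionality of the Hom spaces is carried by [vectType k]. *)
Record lincat (k : fieldType) : Type := LinCat {
  obj :> Type;
  hom : obj -> obj -> vectType k;
  idm : forall X, hom X X;
  compm : forall X Y Z, hom Y Z -> hom X Y -> hom X Z;
  comp1m : forall X Y (f : hom X Y), compm (idm Y) f = f;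
  compm1 : forall X Y (f : hom X Y), compm f (idm X) = f;
  compmA : forall W X Y Z (h : hom Y Z) (g : hom X Y) (f : hom W X),
    compm h (compm g f) = compm (compm h g) f;
  compm_linearl : forall X Y Z (a : k) (g g' : hom Y Z) (f : hom X Y),
    compm (a *: g + g') f = a *: compm g f + compm g' f;
  compm_linearr : forall X Y Z (a : k) (g : hom Y Z) (f f' : hom X Y),
    compm g (a *: f + f') = a *: compm g f + compm g f'
}.

Arguments hom {k l} X Y.
Arguments idm {k l} X.
Notation "g \oc f" := (compm g f) : cat_scope.

Section LinearNotions.
Variables (k : fieldType) (C : lincat k).
Implicit Types X Y Z S : C.

Definition is_iso X Y (f : hom X Y) : Prop :=
  exists g : hom Y X, g \oc f = idm X /\ f \oc g = idm Y.

Definition isomorphic X Y : Prop := exists f : hom X Y, is_iso f.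

Definition is_mono X Y (f : hom X Y) : Prop :=
  forall Z (g h : hom Z X), f \oc g = f \oc h -> g = h.

Definition is_epi X Y (f : hom X Y) : Prop :=
  forall Z (g h : hom Y Z), g \oc f = h \oc f -> g = h.

Definition is_kernel K X Y (f : hom X Y) (i : hom K X) : Prop :=
  f \oc i = 0 /\
  forall Z (g : hom Z X), f \oc g = 0 -> exists! h : hom Z K, i \oc h = g.

Definition is_cokernel X Y Q (f : hom X Y) (q : hom Y Q) : Prop :=
  q \oc f = 0 /\
  forall Z (g : hom Y Z), g \oc f = 0 -> exists! h : hom Q Z, h \oc q = g.

Definition is_zero X : Prop :=
  forall Y, (forall f : hom X Y, f = 0) /\ (forall f : hom Y X, f = 0).

Definition is_biproduct X Y Z : Prop :=
  exists (i : hom X Z) (j : hom Y Z) (p : hom Z X) (q : hom Z Y),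
    [/\ p \oc i = idm X, q \oc j = idm Y, q \oc i = 0, p \oc j = 0
      & i \oc p + j \oc q = idm Z].

Definition is_direct_sum n (S : 'I_n -> C) X : Prop :=
  exists (i : forall a, hom (S a) X) (p : forall a, hom X (S a)),
    [/\ forall a, p a \oc i a = idm (S a),
        forall a b, a != b -> p b \oc i a = 0
      & \sum_(a < n) (i a \oc p a) = idm X].

Definition factor Y X : Prop := exists Z, is_biproduct Y Z X.

Definition simple_object S : Prop :=
  ~ is_zero S /\
  forall U (f : hom U S), is_mono f -> is_zero U \/ is_iso f.

Definition abelian_cat : Prop :=
  [/\ exists Z, is_zero Z,
      forall X Y, exists Z, is_biproduct X Y Z,
      forall X Y (f : hom X Y), exists K (i : hom K X), is_kernel f i,
      forall X Y (f : hom X Y), exists Q (q : hom Y Q), is_cokernel f q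
    & (forall X Y (f : hom X Y), is_mono f ->
         exists Z (g : hom Y Z), is_kernel g f) /\
      (forall X Y (f : hom X Y), is_epi f ->
         exists Z (g : hom Z X), is_cokernel g f)].

Definition semisimple_cat : Prop :=
  abelian_cat /\
  forall X, exists n (S : 'I_n -> C),
    (forall a, simple_object (S a)) /\ is_direct_sum S X.

Definition iso_class X : set C := [set X' | isomorphic X X'].

Definition Lambda : set (set C) := [set iso_class S | S in simple_object].

End LinearNotions.

Arguments Lambda {k} C.
Arguments semisimple_cat {k} C.

Record moncat (k : fieldType) : Type := MonCat {
  mon_lincat :> lincat k;
  unit_obj : mon_lincat;
  tensor : mon_lincat -> mon_lincat -> mon_lincat;
  tensorm : forall X X' Y Y' : mon_lincat,
    hom X X' -> hom Y Y' -> hom (tensor X Y) (tensor X' Y');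
  assoc : forall X Y Z, hom (tensor (tensor X Y) Z) (tensor X (tensor Y Z));
  assocV : forall X Y Z, hom (tensor X (tensor Y Z)) (tensor (tensor X Y) Z);
  lunit : forall X, hom (tensor unit_obj X) X;
  runit : forall X, hom (tensor X unit_obj) X;
  tensorm1 : forall X Y, tensorm (idm X) (idm Y) = idm (tensor X Y);
  tensorm_comp : forall X X' X'' Y Y' Y'' (f' : hom X' X'') (f : hom X X')
    (g' : hom Y' Y'') (g : hom Y Y'),
    tensorm (f' \oc f) (g' \oc g) = tensorm f' g' \oc tensorm f g;
  tensorm_linearl : forall X X' Y Y' (a : k) (f f' : hom X X') (g : hom Y Y'),
    tensorm (a *: f + f') g = a *: tensorm f g + tensorm f' g;
  tensorm_linearr : forall X X' Y Y' (a : k) (f : hom X X') (g g' : hom Y Y'),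
    tensorm f (a *: g + g') = a *: tensorm f g + tensorm f g';
  assocK : forall X Y Z, assocV X Y Z \oc assoc X Y Z = idm _;
  assocVK : forall X Y Z, assoc X Y Z \oc assocV X Y Z = idm _;
  lunit_iso : forall X, is_iso (lunit X);
  runit_iso : forall X, is_iso (runit X);
  assoc_natural : forall X X' Y Y' Z Z'
    (f : hom X X') (g : hom Y Y') (h : hom Z Z'),
    assoc X' Y' Z' \oc tensorm (tensorm f g) h =
    tensorm f (tensorm g h) \oc assoc X Y Z;
  lunit_natural : forall X Y (f : hom X Y),
    lunit Y \oc tensorm (idm unit_obj) f = f \oc lunit X;
  runit_natural : forall X Y (f : hom X Y),
    runit Y \oc tensorm f (idm unit_obj) = f \oc runit X;
  pentagon : forall W X Y Z,
    assoc W X (tensor Y Z) \oc assoc (tensor W X) Y Z =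
    tensorm (idm W) (assoc X Y Z) \oc assoc W (tensor X Y) Z
      \oc tensorm (assoc W X Y) (idm Z);
  triangle : forall X Y,
    tensorm (idm X) (lunit Y) \oc assoc X unit_obj Y =
    tensorm (runit X) (idm Y)
}.

Arguments unit_obj {k m}.
Arguments lunit {k m} X.
Arguments runit {k m} X.
Arguments assoc {k m} X Y Z.
Arguments assocV {k m} X Y Z.
Notation "X \ox Y" := (tensor X Y) : cat_scope.
Notation "f \om g" := (tensorm f g) : cat_scope.

Section Fusion.
Variables (k : fieldType) (C : moncat k).

(* X' is a left dual of X, and X a right dual of X'. *)
Definition is_dual_pair (X' X : C) : Prop :=
  exists (ev : hom (X' \ox X) unit_obj) (coev : hom unit_obj (X \ox X')),
    runit X \oc (idm X \om ev) \oc assoc X X' X \oc (coev \om idm X)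
      = lunit X /\
    lunit X' \oc (ev \om idm X') \oc assocV X' X X' \oc (idm X' \om coev)
      = runit X'.

Definition rigid : Prop :=
  forall X : C, (exists X', is_dual_pair X' X) /\ (exists X', is_dual_pair X X').

Record is_fusion : Prop := IsFusion {
  fusion_semisimple : semisimple_cat C;
  fusion_rigid : rigid;
  fusion_finite : finite_set (Lambda C);
  fusion_End : forall S : C, simple_object S ->
    bijective (fun a : k => a *: idm S);
  fusion_unit : simple_object (unit_obj : C)
}.

Definition trivial_object (X : C) : Prop :=
  exists n, is_direct_sum (fun _ : 'I_n => unit_obj) X.

End Fusion.

Definition full_lincat (k : fieldType) (D : lincat k) (P : set D) : lincat k :=
  @LinCat k {X : D | P X}
    (fun X Y => hom (sval X) (sval Y))
    (fun X => idm (sval X))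
    (fun X Y Z (g : hom (sval Y) (sval Z)) (f : hom (sval X) (sval Y)) =>
       g \oc f)
    (fun X Y => @comp1m k D (sval X) (sval Y))
    (fun X Y => @compm1 k D (sval X) (sval Y))
    (fun W X Y Z => @compmA k D (sval W) (sval X) (sval Y) (sval Z))
    (fun X Y Z => @compm_linearl k D (sval X) (sval Y) (sval Z))
    (fun X Y Z => @compm_linearr k D (sval X) (sval Y) (sval Z)).

Section FullMonoidal.
Variables (k : fieldType) (D : moncat k) (P : set D).
Hypothesis P1 : P unit_obj.
Hypothesis PM : forall X Y : D, P X -> P Y -> P (X \ox Y).

Let E := full_lincat P.
Let unitE : E := exist _ unit_obj P1.
Let tensorE (X Y : E) : E := exist _ (sval X \ox sval Y) (PM (svalP X) (svalP Y)).

Lemma full_is_iso (X Y : E) (f : @hom k D (sval X) (sval Y)) :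
  is_iso f -> @is_iso k E X Y f.
Proof. by []. Qed.

Definition full_moncat : moncat k :=
  @MonCat k E unitE tensorE
    (fun X X' Y Y' (f : @hom k D (sval X) (sval X'))
       (g : @hom k D (sval Y) (sval Y')) => f \om g)
    (fun X Y Z => assoc (sval X) (sval Y) (sval Z))
    (fun X Y Z => assocV (sval X) (sval Y) (sval Z))
    (fun X => lunit (sval X))
    (fun X => runit (sval X))
    (fun X Y => tensorm1 (sval X) (sval Y))
    (fun X X' X'' Y Y' Y'' => @tensorm_comp k D (sval X) (sval X') (sval X'')
                                (sval Y) (sval Y') (sval Y''))
    (fun X X' Y Y' =>
       @tensorm_linearl k D (sval X) (sval X') (sval Y) (sval Y'))
    (fun X X' Y Y' =>
       @tensorm_linearr k D (sval X) (sval X') (sval Y) (sval Y'))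
    (fun X Y Z => assocK (sval X) (sval Y) (sval Z))
    (fun X Y Z => assocVK (sval X) (sval Y) (sval Z))
    (fun X => @full_is_iso (tensorE unitE X) X _ (lunit_iso (sval X)))
    (fun X => @full_is_iso (tensorE X unitE) X _ (runit_iso (sval X)))
    (fun X X' Y Y' Z Z' => @assoc_natural k D (sval X) (sval X')
                             (sval Y) (sval Y') (sval Z) (sval Z'))
    (fun X Y => @lunit_natural k D (sval X) (sval Y))
    (fun X Y => @runit_natural k D (sval X) (sval Y))
    (fun W X Y Z => pentagon (sval W) (sval X) (sval Y) (sval Z))
    (fun X Y => triangle (sval X) (sval Y)).

End FullMonoidal.

Record fusion_subcat (k : fieldType) (D : moncat k) (P : set D) : Prop :=
  FusionSubcat {
    fsub_replete : forall X Y : D, isomorphic X Y -> P X -> P Y;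
    fsub_unit : P unit_obj;
    fsub_tensor : forall X Y : D, P X -> P Y -> P (X \ox Y);
    fsub_fusion : is_fusion (full_moncat fsub_unit fsub_tensor)
  }.

Record tensor_functor (k : fieldType) (C D : moncat k) : Type := TensorFunctor {
  fobj :> C -> D;
  fmap : forall X Y : C, hom X Y -> hom (fobj X) (fobj Y);
  fmap_id : forall X, fmap (idm X) = idm (fobj X);
  fmap_comp : forall X Y Z (g : hom Y Z) (f : hom X Y),
    fmap (g \oc f) = fmap g \oc fmap f;
  fmap_linear : forall X Y (a : k) (f f' : hom X Y),
    fmap (a *: f + f') = a *: fmap f + fmap f';
  fmon : forall X Y, hom (fobj X \ox fobj Y) (fobj (X \ox Y));
  fmon0 : hom unit_obj (fobj unit_obj);
  fmon_iso : forall X Y, is_iso (fmon X Y);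
  fmon0_iso : is_iso fmon0;
  fmon_natural : forall X X' Y Y' (f : hom X X') (g : hom Y Y'),
    fmon X' Y' \oc (fmap f \om fmap g) = fmap (f \om g) \oc fmon X Y;
  fmon_assoc : forall X Y Z,
    fmap (assoc X Y Z) \oc fmon (X \ox Y) Z \oc (fmon X Y \om idm (fobj Z)) =
    fmon X (Y \ox Z) \oc (idm (fobj X) \om fmon Y Z)
      \oc assoc (fobj X) (fobj Y) (fobj Z);
  fmon_lunit : forall X,
    fmap (lunit X) \oc fmon unit_obj X \oc (fmon0 \om idm (fobj X)) =
    lunit (fobj X);
  fmon_runit : forall X,
    fmap (runit X) \oc fmon X unit_obj \oc (idm (fobj X) \om fmon0) =
    runit (fobj X)
}.

Section FunctorNotions.
Variables (k : fieldType) (C D : moncat k) (F : tensor_functor C D).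

Definition normal_functor : Prop :=
  forall X : C, simple_object X -> factor unit_obj (F X) ->
    trivial_object (F X).

(* The intersection of all fusion subcategories containing the objects F X. *)
Definition dominant_image : set D :=
  [set Y | forall P : set D, fusion_subcat P -> (forall X : C, P (F X)) -> P Y].

(* X^F, as a subset of Lambda D *)
Definition up_set (X : C) : set (set D) :=
  [set iso_class Y | Y in [set Y : D | simple_object Y /\ factor Y (F X)]].

(* Y_F, as a subset of Lambda C *)
Definition down_set (Y : D) : set (set C) :=
  [set iso_class X | X in [set X : C | simple_object X /\ factor Y (F X)]].

End FunctorNotions.

Definition disjoint_or_equal (T : Type) (A B : set T) : Prop :=
  A `&` B = set0 \/ A = B.

(* Main.v *)
Require Import Defs.
From mathcomp Require Import all_boot all_order all_algebra.
From mathcomp Require Import boolp classical_sets functions cardinality.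

(** For simple [X : C] and [Y : D], write X R Y when Y is a factor of F X.
    Both (ii) and (iii) say that R is difunctional: X R Y, X' R Y and X' R Y'
    imply X R Y'.  (For (iii) one uses that a simple factor of an object of a
    fusion subcategory belongs to that subcategory, because an object with scalar
    endomorphisms has no proper retract; hence simplicity in D' and in D agree.)
    If R is difunctional and 1 is a factor of F X, comparing X with the unit
    object, for which F 1 = 1, shows that all simple factors of F X are 1.
    Conversely, if F is normal and F X, F W share a simple factor, there is a
    nonzero map F X -> F W, hence by duality a nonzero map 1 -> F (W (x) X' ) with
    X' dual to X, hence a simple factor Z of W (x) X' such that 1 is a factor of
    F Z.  Then F Z is trivial by normality, and W is a factor of Z (x) X by
    duality, so that F W is a factor of F Z (x) F X, a sum of copies of F X. *)

Set Implicit Arguments.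
Unset Strict Implicit.
Unset Printing Implicit Defensive.

Import Defs GRing.Theory.
Local Open Scope classical_set_scope.
Local Open Scope ring_scope.
Local Open Scope cat_scope.

(** * Bilinear composition, isomorphisms, retracts and direct sums in a linear category *)

Section LinearCategory.
Variables (k : fieldType) (C : lincat k).
Implicit Types X Y Z S T : C.

Lemma compmDl X Y Z (g g' : hom Y Z) (f : hom X Y) :
  (g + g') \oc f = g \oc f + g' \oc f.
Proof. by rewrite -[g in LHS]scale1r compm_linearl scale1r. Qed.

Lemma compmDr X Y Z (g : hom Y Z) (f f' : hom X Y) :
  g \oc (f + f') = g \oc f + g \oc f'.
Proof. by rewrite -[f in LHS]scale1r compm_linearr scale1r. Qed.

Lemma comp0m X Y Z (f : hom X Y) : (0 : hom Y Z) \oc f = 0.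
Proof. by apply: (addrI (0 \oc f)); rewrite -compmDl !addr0. Qed.

Lemma compm0 X Y Z (g : hom Y Z) : g \oc (0 : hom X Y) = 0.
Proof. by apply: (addrI (g \oc 0)); rewrite -compmDr !addr0. Qed.

Lemma compZm X Y Z a (g : hom Y Z) (f : hom X Y) :
  (a *: g) \oc f = a *: (g \oc f).
Proof. by rewrite -[a *: g]addr0 compm_linearl comp0m addr0. Qed.

Lemma compmBl X Y Z (g g' : hom Y Z) (f : hom X Y) :
  (g - g') \oc f = g \oc f - g' \oc f.
Proof. by rewrite compmDl -scaleN1r compZm scaleN1r. Qed.

Lemma compmBr X Y Z (g : hom Y Z) (f f' : hom X Y) :
  g \oc (f - f') = g \oc f - g \oc f'.
Proof. by apply/eqP; rewrite eq_sym subr_eq -compmDr subrK. Qed.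

Lemma compm_suml X Y Z I (r : seq I) (g : I -> hom Y Z) (f : hom X Y) :
  (\sum_(a <- r) g a) \oc f = \sum_(a <- r) (g a \oc f).
Proof.
exact: (big_morph (fun g => g \oc f) (fun g g' => compmDl g g' f) (comp0m _ f)).
Qed.

Lemma compm_sumr X Y Z I (r : seq I) (g : hom Y Z) (f : I -> hom X Y) :
  g \oc (\sum_(a <- r) f a) = \sum_(a <- r) (g \oc f a).
Proof. exact: (big_morph (compm g) (compmDr g) (compm0 _ g)). Qed.

Lemma kernel_mono K X Y (f : hom X Y) (i : hom K X) :
  is_kernel f i -> is_mono i.
Proof.
move=> [fi univ] Z g h gh.
have fg : f \oc (i \oc g) = 0 by rewrite compmA fi comp0m.
have [u [_ uniq]] := univ _ _ fg.
by rewrite -(uniq g) // -(uniq h).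
Qed.

Lemma is_zeroP X : is_zero X <-> idm X = 0.
Proof.
split=> [X0|X0 Y]; first exact: (X0 X).1.
split=> f; first by rewrite -[f]compm1 X0 compm0.
by rewrite -[f]comp1m X0 comp0m.
Qed.

Lemma simple_idm S : simple_object S -> idm S <> 0.
Proof. by move=> [S0 _] /is_zeroP. Qed.

Lemma isomorphic_refl X : isomorphic X X.
Proof. by exists (idm X), (idm X); rewrite !comp1m. Qed.

Lemma isomorphic_sym X Y : isomorphic X Y -> isomorphic Y X.
Proof. by move=> [f [g [gf fg]]]; exists g, f. Qed.

Lemma isomorphic_trans X Y Z :
  isomorphic X Y -> isomorphic Y Z -> isomorphic X Z.
Proof.
move=> [f [g [gf fg]]] [f' [g' [gf' fg']]]; exists (f' \oc f), (g \oc g').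
split; first by rewrite compmA -(compmA g) gf' compm1.
by rewrite compmA -(compmA f') fg compm1.
Qed.

Lemma iso_classP X Y : iso_class X = iso_class Y <-> isomorphic X Y.
Proof.
split=> [XY|XY].
  have : iso_class Y Y by exact: isomorphic_refl.
  by rewrite -XY.
apply/seteqP; split=> Z; first exact/isomorphic_trans/isomorphic_sym.
exact: isomorphic_trans.
Qed.

Lemma simple_iso X Y : isomorphic X Y -> simple_object X -> simple_object Y.
Proof.
move=> [j [q [qj jq]]] [X0 subX]; split=> [/is_zeroP Y0|U f fmono].
  by apply/X0/is_zeroP; rewrite -qj -[j]comp1m Y0 comp0m compm0.
have gmono : is_mono (q \oc f).
  move=> Z u v /(congr1 (compm j)); rewrite !compmA jq !comp1m.
  exact: fmono.
case: (subX _ _ gmono) => [U0|[h [hg gh]]]; [by left|right].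
exists (h \oc q); split; first by rewrite -compmA.
have := congr1 (fun x => j \oc x \oc q) gh.
by rewrite !compmA jq comp1m compm1 jq.
Qed.

(** Unlike [factor], this asks for no complement, so it composes and passes through functors at
    once; [factorP] identifies the two notions in the semisimple case. *)
Definition retract Y X : Prop :=
  exists (f : hom Y X) (r : hom X Y), r \oc f = idm Y.

Lemma isomorphic_retract X Y : isomorphic X Y -> retract X Y.
Proof. by move=> [f [g [gf _]]]; exists f, g. Qed.

Lemma retract_trans X Y Z : retract X Y -> retract Y Z -> retract X Z.
Proof.
move=> [f [r rf]] [f' [r' rf']]; exists (f' \oc f), (r \oc r').
by rewrite compmA -(compmA r) rf' compm1.
Qed.

(** Since the identity of [X] is the sum of the [i a \oc p a], a map whose components all vanish is
    zero. *)
Lemma direct_sum_neq0l n (S : 'I_n -> C) X Y (f : hom Y X) :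
    is_direct_sum S X -> f <> 0 ->
  exists a (i : hom (S a) X) (p : hom X (S a)),
    p \oc i = idm (S a) /\ p \oc f <> 0.
Proof.
move=> [i [p [pi _ ip]]] f0; apply: contrapT => H; apply: f0.
rewrite -[f]comp1m -ip compm_suml big1 // => a _.
have [pf|pf] := pselect (p a \oc f = 0); first by rewrite -compmA pf compm0.
by case: H; exists a, (i a), (p a).
Qed.

Lemma direct_sum_neq0r n (S : 'I_n -> C) X Y (f : hom X Y) :
    is_direct_sum S X -> f <> 0 ->
  exists a (i : hom (S a) X), f \oc i <> 0.
Proof.
move=> [i [p [pi _ ip]]] f0; apply: contrapT => H; apply: f0.
rewrite -[f]compm1 -ip compm_sumr big1 // => a _.
have [pf|pf] := pselect (f \oc i a = 0); first by rewrite compmA pf comp0m.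
by case: H; exists a, (i a).
Qed.

Lemma direct_sum_iso n (S T : 'I_n -> C) X :
    (forall a, isomorphic (S a) (T a)) -> is_direct_sum S X ->
  is_direct_sum T X.
Proof.
move=> ST [i [p [pi pi0 ip]]].
(* Isomorphisms and their inverses are chosen for all indices simultaneously. *)
have [f [g gf]] : exists (f : forall a, hom (S a) (T a))
    (g : forall a, hom (T a) (S a)),
    forall a, g a \oc f a = idm (S a) /\ f a \oc g a = idm (T a).
  exists (fun a => projT1 (cid (ST a))).
  exists (fun a => projT1 (cid (projT2 (cid (ST a))))) => a.
  exact: projT2 (cid (projT2 (cid (ST a)))).
exists (fun a => i a \oc g a), (fun a => f a \oc p a); split.
- move=> a; rewrite compmA -(compmA (f a)) pi compm1; exact: (gf a).2.
- by move=> a b ab; rewrite compmA -(compmA (f b)) pi0 // compm0 comp0m.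
- rewrite -ip; apply: eq_bigr => a _.
  by rewrite compmA -(compmA (i a)) (gf a).1 compm1.
Qed.

(** * Factors, Schur's lemma and splittings in a semisimple category *)

Section Semisimple.
Hypothesis ssC : semisimple_cat C.

(** The complement of a retract is the kernel of the retraction [r]; the projection onto it comes
    from factoring [idm X - f \oc r], which [r] kills. *)
Lemma factorP Y X : factor Y X <-> retract Y X.
Proof.
split=> [[Z [i [j [p [q [pi _ _ _ _]]]]]]|[f [r rf]]]; first by exists i, p.
have [[_ _ kerC _ _] _] := ssC.
have [K [i [ri univ]]] := kerC _ _ r.
have i_mono := kernel_mono (conj ri univ).
have rB : r \oc (idm X - f \oc r) = 0.
  by rewrite compmBr compm1 compmA rf comp1m subrr.
have [s [is_ _]] := univ _ _ rB.
exists K, f, i, r, s; split=> //.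
- apply: i_mono; rewrite compmA is_ compmBl comp1m compm1 -compmA ri compm0.
  by rewrite subr0.
- apply: i_mono; rewrite compmA is_ compmBl comp1m compm0 -compmA rf compm1.
  by rewrite subrr.
- by rewrite is_ addrC subrK.
Qed.

(** The kernel of [f] is a subobject of [S], not all of it since [f] is nonzero, so [f] is mono;
    then the simplicity of [T] applies to [f] itself. *)
Lemma Schur S T (f : hom S T) :
  simple_object S -> simple_object T -> f <> 0 -> is_iso f.
Proof.
move=> [S0 subS] [T0 subT] f0.
have [[_ _ kerC _ _] _] := ssC.
have [K [i [fi univ]]] := kerC _ _ f.
have i_mono := kernel_mono (conj fi univ).
have f_mono : is_mono f.
  case: (subS _ _ i_mono) => [K0|[j [_ ij]]]; last first.
    by case: f0; rewrite -[f]compm1 -ij compmA fi comp0m.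
  move=> Z g h gh; have fB : f \oc (g - h) = 0 by rewrite compmBr gh subrr.
  have [u [iu _]] := univ _ _ fB.
  by apply/eqP; rewrite -subr_eq0 -iu ((K0 Z).2 u) compm0.
by case: (subT _ _ f_mono).
Qed.

(** Some component of [f] on a simple summand of [X] is nonzero, hence invertible by [Schur]; its
    inverse after the projection is the retraction. *)
Lemma simple_sub_split Y X (f : hom Y X) :
  simple_object Y -> f <> 0 -> exists r : hom X Y, r \oc f = idm Y.
Proof.
move=> sY f0; have [n [S [sS dS]]] := ssC.2 X.
have [a [i [p [_ pf]]]] := direct_sum_neq0l dS f0.
have [g [gpf _]] := Schur sY (sS a) pf.
by exists (g \oc p); rewrite -compmA.
Qed.

Lemma simple_quotient_split Y X (f : hom X Y) :
  simple_object Y -> f <> 0 -> exists s : hom Y X, f \oc s = idm Y.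
Proof.
move=> sY f0; have [n [S [sS dS]]] := ssC.2 X.
have [a [i fi]] := direct_sum_neq0r dS f0.
have [g [_ fig]] := Schur (sS a) sY fi.
by exists (i \oc g); rewrite compmA.
Qed.

Lemma factor_isol Y Y' X : isomorphic Y Y' -> factor Y X -> factor Y' X.
Proof.
move=> YY' /factorP YX; apply/factorP; apply: retract_trans YX.
exact/isomorphic_retract/isomorphic_sym.
Qed.

Lemma factor_isor Y X X' : isomorphic X X' -> factor Y X -> factor Y X'.
Proof.
move=> XX' /factorP YX; apply/factorP; apply: retract_trans YX _.
exact: isomorphic_retract.
Qed.

End Semisimple.
End LinearCategory.

(** * Tensor products of maps and transposition along a dual pair *)

Section Monoidal.
Variables (k : fieldType) (C : moncat k).
Implicit Types X Y Z W A B : C.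

Lemma tensormDl X X' Y Y' (f f' : hom X X') (g : hom Y Y') :
  (f + f') \om g = f \om g + f' \om g.
Proof. by rewrite -[f in LHS]scale1r tensorm_linearl scale1r. Qed.

Lemma tensor0m X X' Y Y' (g : hom Y Y') : (0 : hom X X') \om g = 0.
Proof. by apply: (addrI (0 \om g)); rewrite -tensormDl !addr0. Qed.

Lemma tensorm_suml X X' Y Y' I (r : seq I) (f : I -> hom X X') (g : hom Y Y') :
  (\sum_(a <- r) f a) \om g = \sum_(a <- r) (f a \om g).
Proof.
exact: (big_morph (fun f => f \om g) (fun f f' => tensormDl f f' g)
          (tensor0m _ _ g)).
Qed.

Lemma tensor_direct_sum n (S : 'I_n -> C) A B :
  is_direct_sum S A -> is_direct_sum (fun a => S a \ox B) (A \ox B).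
Proof.
move=> [i [p [pi pi0 ip]]].
exists (fun a => i a \om idm B), (fun a => p a \om idm B); split.
- by move=> a; rewrite -tensorm_comp pi comp1m tensorm1.
- by move=> a b ab; rewrite -tensorm_comp pi0 // tensor0m.
- rewrite -tensorm1 -ip tensorm_suml.
  by apply: eq_bigr => a _; rewrite -tensorm_comp comp1m.
Qed.

Lemma tensorm_compl X X' X'' Y (f' : hom X' X'') (f : hom X X') :
  (f' \oc f) \om idm Y = (f' \om idm Y) \oc (f \om idm Y).
Proof. by rewrite -tensorm_comp comp1m. Qed.

Lemma tensorm_compr X X' X'' Y (f' : hom X' X'') (f : hom X X') :
  idm Y \om (f' \oc f) = (idm Y \om f') \oc (idm Y \om f).
Proof. by rewrite -tensorm_comp comp1m. Qed.

Lemma tensorm_swap X X' Y Y' (f : hom X X') (g : hom Y Y') :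
  (f \om idm Y') \oc (idm X \om g) = (idm X' \om g) \oc (f \om idm Y).
Proof. by rewrite -!tensorm_comp !comp1m !compm1. Qed.

Lemma assocV_natural X X' Y Y' Z Z'
    (f : hom X X') (g : hom Y Y') (h : hom Z Z') :
  ((f \om g) \om h) \oc assocV X Y Z = assocV X' Y' Z' \oc (f \om (g \om h)).
Proof.
rewrite -[LHS]comp1m -(assocK X' Y' Z') -compmA; congr (_ \oc _).
by rewrite compmA assoc_natural -compmA assocVK compm1.
Qed.

Lemma tensorm_unit_inj X Y (g : hom X Y) : g \om idm unit_obj = 0 -> g = 0.
Proof.
move=> g0; have [s [_ rs]] := runit_iso X.
by rewrite -[g]compm1 -rs compmA -runit_natural g0 compm0 comp0m.
Qed.

Section DualPair.
Variables (W' W : C) (ev : hom (W' \ox W) unit_obj).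
Variable (coev : hom unit_obj (W \ox W')).

(** Transposition is injective: sliding [h] through the zigzag until it meets [coev] expresses [h]
    through its transpose. *)
Lemma mate_neq0 X (h : hom W X) :
    runit W \oc (idm W \om ev) \oc assoc W W' W \oc (coev \om idm W) = lunit W ->
  h <> 0 -> (h \om idm W') \oc coev <> 0.
Proof.
move=> zigzag h0 g0; apply: h0.
have [s [_ ls]] := lunit_iso W.
rewrite -[h]compm1 -ls compmA -zigzag !compmA -runit_natural.
rewrite -(compmA (runit X)) tensorm_swap -!compmA (compmA (h \om _)).
rewrite -tensorm1 -assoc_natural -!compmA (compmA (_ \om idm W)).
by rewrite -tensorm_compl g0 tensor0m comp0m !compm0.
Qed.

(** Transposing back, by tensoring with [W'] and precomposing with [coev], recovers [g] up to unit
    and associativity isomorphisms, by the other zigzag. *)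
Lemma comate_neq0 X Z (g : hom Z (X \ox W')) :
    lunit W' \oc (ev \om idm W') \oc assocV W' W W' \oc (idm W' \om coev)
      = runit W' ->
  g <> 0 -> runit X \oc (idm X \om ev) \oc assoc X W' W \oc (g \om idm W) <> 0.
Proof.
move=> zigzag g0 /(congr1 (fun f => (f \om idm W') \oc assocV Z W W'
                                     \oc (idm Z \om coev))).
rewrite tensor0m !comp0m !tensorm_compl -!compmA.
rewrite (compmA ((g \om _) \om _)) assocV_natural tensorm1 -!compmA tensorm_swap.
rewrite -triangle -!compmA (compmA (assoc X _ _)) assoc_natural -!compmA.
(* The pentagon solved for the side that occurs here, with one associator inverted. *)
have pent : assoc X (W' \ox W) W' \oc (assoc X W' W \om idm W') =
    (idm X \om assocV W' W W') \oc assoc X W' (W \ox W')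
      \oc assoc (X \ox W') W W'.
  rewrite -(compmA _ (assoc X W' _)) pentagon !compmA -tensorm_compr assocK.
  by rewrite tensorm1 comp1m.
rewrite (compmA (assoc X (W' \ox W) W')) pent -!compmA.
rewrite (compmA (assoc (X \ox W') W W')) assocVK comp1m.
rewrite (compmA (assoc X W' (W \ox W'))) -tensorm1 assoc_natural.
rewrite !compmA -!tensorm_compr zigzag => Mg0; apply: g0.
(* What remains of the vanishing transpose is [g \om idm unit_obj] followed by an associator and
   [idm X \om runit W']; both are cancelled. *)
apply: tensorm_unit_inj.
have [s [sr _]] := runit_iso W'.
move: (congr1 (fun f => assocV _ _ _ \oc ((idm X \om s) \oc f)) Mg0).
rewrite !compm0 -!compmA (compmA (idm X \om s)) -tensorm_compr sr tensorm1.
by rewrite comp1m compmA assocK comp1m.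
Qed.

End DualPair.
End Monoidal.

(** * Preservation of retracts, direct sums and duals by tensor functors *)

Section TensorFunctor.
Variables (k : fieldType) (C D : moncat k) (F : tensor_functor C D).
Implicit Types X Y W Z : C.

Lemma fmapD X Y (f f' : hom X Y) : fmap F (f + f') = fmap F f + fmap F f'.
Proof. by rewrite -[f in LHS]scale1r fmap_linear scale1r. Qed.

Lemma fmap0 X Y : fmap F (0 : hom X Y) = 0.
Proof. by apply: (addrI (fmap F 0)); rewrite -fmapD !addr0. Qed.

Lemma fmap_retract X Y : retract X Y -> retract (F X) (F Y).
Proof.
move=> [f [r rf]]; exists (fmap F f), (fmap F r).
by rewrite -fmap_comp rf fmap_id.
Qed.

Lemma fmap_isomorphic X Y : isomorphic X Y -> isomorphic (F X) (F Y).
Proof.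
move=> [f [g [gf fg]]]; exists (fmap F f), (fmap F g).
by rewrite -!fmap_comp gf fg !fmap_id.
Qed.

Lemma fmap_direct_sum n (S : 'I_n -> C) X :
  is_direct_sum S X -> is_direct_sum (fun a => F (S a)) (F X).
Proof.
move=> [i [p [pi pi0 ip]]].
exists (fun a => fmap F (i a)), (fun a => fmap F (p a)); split.
- by move=> a; rewrite -fmap_comp pi fmap_id.
- by move=> a b ab; rewrite -fmap_comp pi0 // fmap0.
- rewrite -fmap_id -ip (big_morph (@fmap k C D F X X) (@fmapD X X) (fmap0 X X)).
  by apply: eq_bigr => a _; rewrite fmap_comp.
Qed.

(** The zigzag on [F W] is the image of the one on [W]. The maps [ev'] and [coev'] enter through
    equations, which keeps inverses of [fmon] and [fmon0] out of the diagram chase. *)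
Lemma fmap_zigzag W' W (ev : hom (W' \ox W) unit_obj)
    (coev : hom unit_obj (W \ox W')) (ev' : hom (F W' \ox F W) unit_obj)
    (coev' : hom unit_obj (F W \ox F W')) :
    runit W \oc (idm W \om ev) \oc assoc W W' W \oc (coev \om idm W) = lunit W ->
    fmon0 F \oc ev' = fmap F ev \oc fmon F W' W ->
    fmon F W W' \oc coev' = fmap F coev \oc fmon0 F ->
  runit (F W) \oc (idm (F W) \om ev') \oc assoc (F W) (F W') (F W)
    \oc (coev' \om idm (F W)) = lunit (F W).
Proof.
move=> zigzag evE coevE.
rewrite -[RHS]fmon_lunit -zigzag !fmap_comp -!compmA.
rewrite (compmA (fmap F (coev \om _))) -fmon_natural fmap_id -!compmA.
rewrite -tensorm_compl -coevE tensorm_compl.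
rewrite (compmA (fmon F _ W)) (compmA (fmap F (assoc _ _ _))).
rewrite (compmA (fmap F (assoc _ _ _))) fmon_assoc -!compmA.
rewrite (compmA (fmap F (_ \om ev))) -fmon_natural fmap_id -!compmA.
rewrite (compmA (idm _ \om fmap F ev)) -tensorm_compr -evE tensorm_compr.
by rewrite -fmon_runit !compmA.
Qed.

End TensorFunctor.

(** * Simple objects of the dominant image and factors of the objects [F X] *)

Section FusionFunctor.
Variables (k : fieldType) (C D : moncat k).
Hypotheses (hC : is_fusion C) (hD : is_fusion D).
Variable F : tensor_functor C D.

Let ssC := fusion_semisimple hC.
Let ssD := fusion_semisimple hD.

Lemma up_setP X (S : D) : simple_object S ->
  up_set F X (iso_class S) <-> factor S (F X).
Proof.
move=> sS; split=> [[Y [sY YX] /iso_classP YS]|SX]; last by exists S.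
exact: (factor_isol ssD YS).
Qed.

Lemma down_setP (X : C) (Y : D) : simple_object X ->
  down_set F Y (iso_class X) <-> factor Y (F X).
Proof.
move=> sX; split=> [[X' [sX' YX] /iso_classP XX']|YX]; last by exists X.
exact: (factor_isor ssD (fmap_isomorphic F XX')).
Qed.

(** [A] is decomposed inside the subcategory and [S] meets some summand [T a]. As [T a] is known to
    be simple only there, its scalar endomorphisms replace [Schur] in proving it isomorphic to
    [S]. *)
Lemma fusion_subcat_factor (P : set D) (A S : D) :
  fusion_subcat P -> P A -> simple_object S -> factor S A -> P S.
Proof.
move=> hP PA sS /(factorP ssD)[f [r rf]].
have f0 : f <> 0.
  by move=> f0; apply: (simple_idm sS); rewrite -rf f0 compm0.
have hE := fsub_fusion hP.
have [n [T [sT [i [p [pi pi0 ip]]]]]] :=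
  (fusion_semisimple hE).2 (exist _ A PA).
(* The subcategory is full with the same composition, so its decomposition is also one in [D]. *)
have dT : is_direct_sum (fun a => sval (T a)) A by exists i, p; split.
have [a [j [q [_ qf0]]]] := direct_sum_neq0l dT f0.
have [s sqf] := simple_sub_split ssD sS qf0.
have [c' _ cE] := fusion_End hE (sT a).
have [c scal] : exists c, q \oc f \oc s = c *: idm (sval (T a)).
  by exists (c' (q \oc f \oc s)); symmetry; exact: (cE (q \oc f \oc s)).
apply: (fsub_replete hP) (svalP (T a)).
exists s, (q \oc f); split => //.
(* [q \oc f \oc s] is a scalar [c], and [c = 1] since it fixes [q \oc f <> 0] *)
have : c *: (q \oc f) = q \oc f.
  rewrite -[q \oc f in X in _ *: X]comp1m -compZm -scal -(compmA _ s) sqf.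
  by rewrite compm1.
rewrite scal => /eqP.
rewrite -subr_eq0 -{2}[q \oc f]scale1r -scalerBl scaler_eq0 subr_eq0.
by move=> /orP[/eqP ->|/eqP //]; rewrite scale1r.
Qed.

Lemma dominant_image_factor (A S : D) :
  dominant_image F A -> simple_object S -> factor S A -> dominant_image F S.
Proof.
by move=> dA sS SA P hP PF; apply: (fusion_subcat_factor hP (dA P hP PF)).
Qed.

Lemma dominant_image_fobj X : dominant_image F (F X).
Proof. by move=> P _; exact. Qed.

(** A nonzero map to a simple object of [D] has a section, which fullness keeps in the subcategory;
    a mono with a section is invertible. *)
Lemma simple_full (P : set D) (Y : full_lincat P) :
  simple_object (sval Y) -> simple_object Y.
Proof.
move=> sY; split=> [/is_zeroP|U f fmono]; first exact: (simple_idm sY).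
have [f0|f0] := pselect (f = 0).
  left; apply/is_zeroP; apply: fmono; by rewrite f0 !comp0m.
right; have [s fs] := simple_quotient_split ssD sY f0.
exists s; split => //.
by apply: fmono; rewrite compmA compm1 [f \oc s]fs comp1m.
Qed.

(** A summand of [Y] that is simple in [D] lies in the dominant image and is a subobject there, so
    it must be all of [Y]. *)
Lemma simple_dominant_image (Y : full_lincat (dominant_image F)) :
  simple_object Y -> simple_object (sval Y).
Proof.
move=> [Y0 subY].
have [n [S [sS dS]]] := ssD.2 (sval Y).
have id0 : idm (sval Y) <> 0 by move=> id0; apply/Y0/is_zeroP.
have [a [j [q [qj _]]]] := direct_sum_neq0l dS id0.
have dSa : dominant_image F (S a).
  apply: dominant_image_factor (svalP Y) (sS a) _.
  by apply/(factorP ssD); exists j, q.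
pose Sa : full_lincat (dominant_image F) := exist _ (S a) dSa.
have jmono : @is_mono k (full_lincat (dominant_image F)) Sa Y j.
  move=> Z g h gh.
  have qjK (u : @hom k D (sval Z) (S a)) : q \oc (j \oc u) = u.
    by rewrite compmA qj comp1m.
  exact: etrans (esym (qjK g)) (etrans (congr1 (compm q) gh) (qjK h)).
case: (subY _ _ jmono) => [/is_zeroP Sa0|[q' [q'j jq']]].
  by case: (simple_idm (sS a)).
have YSa : isomorphic (S a) (sval Y) by exists j, q'.
exact: simple_iso YSa (sS a).
Qed.

Lemma factor_fobj_unit (S : D) :
  simple_object S -> factor S (F unit_obj) -> isomorphic S unit_obj.
Proof.
move=> sS /(factorP ssD)[f [r rf]].
have [e [_ e0]] := fmon0_iso F.
exists (e \oc f); apply: (Schur ssD sS (fusion_unit hD)) => ef0.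
apply: (simple_idm sS); rewrite -rf -[f]comp1m -e0 -(compmA _ e) ef0.
by rewrite !compm0.
Qed.

Lemma factor_unit_fobj : factor unit_obj (F unit_obj).
Proof.
apply/(factorP ssD)/isomorphic_retract.
by exists (fmon0 F); exact: fmon0_iso.
Qed.

(** * Difunctionality of the factor relation and its equivalence with each assertion *)

Definition difunctional : Prop :=
  forall (X X' : C) (Y Y' : D), simple_object X -> simple_object X' ->
    simple_object Y -> simple_object Y' ->
    factor Y (F X) -> factor Y (F X') -> factor Y' (F X') -> factor Y' (F X).

Lemma difunctional_up_set : difunctional <->
  forall X X' : C, simple_object X -> simple_object X' ->
    disjoint_or_equal (up_set F X) (up_set F X').
Proof.
split=> [dF X X' sX sX'|H X X' Y Y' sX sX' sY sY' YX YX' Y'X'].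
  have [?|/set0P[_ [[Y [sY YX] <-] /(up_setP _ sY) YX']]] :=
    eqVneq (up_set F X `&` up_set F X') set0; first by left.
  right; apply/seteqP; split=> _ [Y' [sY' Y'X] <-].
    by apply/(up_setP _ sY'); apply: (dF X' X Y Y').
  by apply/(up_setP _ sY'); apply: (dF X X' Y Y').
apply/(up_setP _ sY'); case: (H X X' sX sX') => [/seteqP[XX' _]|->].
  by case: (XX' (iso_class Y)); split; apply/up_setP.
exact/up_setP.
Qed.

(** Restricting to the dominant image loses nothing, as every simple factor of an [F X] lies in
    it. *)
Lemma difunctional_down_set : difunctional <->
  forall Y Y' : full_lincat (dominant_image F),
    simple_object Y -> simple_object Y' ->
    disjoint_or_equal (down_set F (sval Y)) (down_set F (sval Y')).
Proof.
split=> [dF Y Y' /simple_dominant_image sY /simple_dominant_image sY'|H].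
  have [?|/set0P[_ [[X [sX YX] <-] /(down_setP _ sX) Y'X]]] :=
    eqVneq (down_set F (sval Y) `&` down_set F (sval Y')) set0; first by left.
  right; apply/seteqP; split=> _ [X' [sX' YX'] <-]; apply/(down_setP _ sX').
    exact: (dF X' X (sval Y) (sval Y')).
  exact: (dF X' X (sval Y') (sval Y)).
move=> X X' Y Y' sX sX' sY sY' YX YX' Y'X'.
have dY : dominant_image F Y.
  exact: dominant_image_factor (dominant_image_fobj X) _ _.
have dY' : dominant_image F Y'.
  exact: dominant_image_factor (dominant_image_fobj X') _ _.
apply/(down_setP _ sX).
pose fY : full_lincat (dominant_image F) := exist _ Y dY.
pose fY' : full_lincat (dominant_image F) := exist _ Y' dY'.
have := H fY fY' (@simple_full _ fY sY) (@simple_full _ fY' sY').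
case=> /= [/seteqP[YY' _]|<-].
  by case: (YY' (iso_class X')); split; apply/down_setP.
exact/down_setP.
Qed.

Lemma difunctional_normal : difunctional -> normal_functor F.
Proof.
move=> dF X sX unitX.
have [n [S [sS dS]]] := ssD.2 (F X).
exists n; apply: (direct_sum_iso _ dS) => a.
have SaX : factor (S a) (F X).
  case: dS => i [p [pi _ _]]; apply/(factorP ssD).
  by exists (i a), (p a).
apply: factor_fobj_unit (sS a) _.
exact: (dF _ X unit_obj _ (fusion_unit hC) sX (fusion_unit hD) (sS a)
          factor_unit_fobj unitX SaX).
Qed.

Lemma normal_difunctional : normal_functor F -> difunctional.
Proof.
move=> nF X W Y Y' sX sW sY sY' /(factorP ssD)[i [p pi]].
move=> /(factorP ssD)[j [q qj]] /(factorP ssD) Y'W.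
have h0 : j \oc p <> 0.
  move=> jp0; apply: (simple_idm sY).
  by rewrite -(comp1m (idm Y)) -{1}qj -pi !compmA -(compmA q) jp0 compm0 comp0m.
have [X' [ev [coev [zigzag1 zigzag2]]]] := (fusion_rigid hC X).1.
have [e0 [_ e0K]] := fmon0_iso F.
have [m [_ mK]] := fmon_iso F X X'.
(* The dual pair on [X] is transported along [F], so that [j \oc p] from [F X] to [F W] can be
   transposed. *)
pose ev' := e0 \oc (fmap F ev \oc fmon F X' X).
pose coev' := m \oc (fmap F coev \oc fmon0 F).
have ev'E : fmon0 F \oc ev' = fmap F ev \oc fmon F X' X.
  by rewrite compmA e0K comp1m.
have coev'E : fmon F X X' \oc coev' = fmap F coev \oc fmon0 F.
  by rewrite compmA mK comp1m.
have g0 := mate_neq0 (fmap_zigzag zigzag1 ev'E coev'E) h0.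
have [m' [m'K _]] := fmon_iso F W X'.
(* Moving the transpose into [F (W \ox X')] lets a decomposition of [W \ox X'] in [C] detect it. *)
have g'0 : fmon F W X' \oc (((j \oc p) \om idm (F X')) \oc coev') <> 0.
  by move=> g'0; apply: g0; rewrite -[LHS]comp1m -m'K -compmA g'0 compm0.
have [n [Z [sZ dZ]]] := ssC.2 (W \ox X').
have [a [_ [pz [_ pg0]]]] := direct_sum_neq0l (fmap_direct_sum F dZ) g'0.
have unitZ : factor unit_obj (F (Z a)).
  have [r rE] := simple_sub_split ssD (fusion_unit hD) pg0.
  by apply/(factorP ssD); eexists; exists r; exact: rE.
have [n' trivZ] := nF _ (sZ a) unitZ.
have [iz [qz [qiz _ _]]] := dZ.
have iz0 : iz a <> 0.
  by move=> iz0; apply: (simple_idm (sZ a)); rewrite -qiz iz0 compm0.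
(* The inclusion of [Z a] in [W \ox X'] transposes to a nonzero map from [Z a \ox X] to the simple
   object [W], which splits. *)
have [s tE] := simple_quotient_split ssC sW (comate_neq0 zigzag2 iz0).
have WZX : retract W (Z a \ox X) by exists s; eexists; exact: tE.
have [f [r rf]] : retract Y' (F (Z a) \ox F X).
  apply: retract_trans Y'W (retract_trans (fmap_retract F WZX) _).
  apply/isomorphic_retract/isomorphic_sym.
  by exists (fmon F (Z a) X); exact: fmon_iso.
have f0 : f <> 0 by move=> f0; apply: (simple_idm sY'); rewrite -rf f0 compm0.
(* By normality [F (Z a) \ox F X] is a sum of copies of [unit_obj \ox F X], and [Y'] meets one of
   them. *)
have [b [_ [pb [_ pf0]]]] := direct_sum_neq0l (tensor_direct_sum (F X) trivZ) f0.
have [t tpf] := simple_sub_split ssD sY' pf0.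
apply: (@factor_isor _ _ ssD _ (unit_obj \ox F X)).
  by exists (lunit (F X)); exact: lunit_iso.
by apply/(factorP ssD); exists (pb \oc f), t.
Qed.

End FusionFunctor.

Theorem corollary4p3 (k : fieldType) (C D : moncat k)
    (hC : is_fusion C) (hD : is_fusion D) (F : tensor_functor C D) :
  [<-> normal_functor F;
       forall X X' : C, simple_object X -> simple_object X' ->
         disjoint_or_equal (up_set F X) (up_set F X');
       forall Y Y' : full_lincat (dominant_image F),
         simple_object Y -> simple_object Y' ->
         disjoint_or_equal (down_set F (sval Y)) (down_set F (sval Y'))].
Proof.
tfae.
- by move=> nF; apply/difunctional_up_set/normal_difunctional.
- by move=> H; apply/difunctional_down_set => //; apply/difunctional_up_set.
- by move=> H; apply: difunctional_normal => //; apply/difunctional_down_set.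
Qed.
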